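(* Let $\lambda$ be any of the four invariants RP, RE, CP, CE, let $k\ge m+2>2$ be integers, and let $\mathbf{k}=\{k,k-1,\dots,k-m-1\}$. Then for a metric space $X$, $\Lambda^m_{\mathbf{k}}(X)$ determines the isometry type of $X$.
   Context: For a metric space $S$, the Rips and Čech filtrations are filtrations of the full simplicial complex on $S$ (all nonempty finite subsets of $S$). In the Rips filtration a simplex $\sigma$ enters at parameter $\max_{x,y\in\sigma}d(x,y)$. In the Čech filtration $\sigma$ enters when the balls of equal radius around its vertices acquire a common point (for a point cloud in Euclidean space, balls in that Euclidean space), the parameter being normalized so that for a two-point space $\{x,y\}$ the edge enters at $d(x,y)$. Vertices enter at $0$. The invariants: Rips persistence RP and Čech persistence CP assign to $S$ the persistence diagrams, in every homological degree, of the Rips, resp. Čech, filtration. The Rips Euler curve RE and Čech Euler curve CE assign to $S$ the function sending $r$ to the Euler characteristic of the complex of simplices that have entered by parameter $r$ in the Rips, resp. Čech, filtration. For $\lambda$ one of these, $\lambda^m$ is the same invariant restricted to the $m$-skeleton of the Rips, resp. Čech, complex. For an integer $j>0$, $\Lambda^m_j(X)=\{(S,\lambda^m(S)) : S\subseteq X,\ |S|=j\}$, and $\Lambda^m_{\mathbf{k}}(X)=\bigcup_{j\in\mathbf{k}}\Lambda^m_j(X)$. ''Determines the isometry type'' means: if two metrics on the same underlying set $X$ have the same $\Lambda^m_{\mathbf{k}}$, then the two metric spaces are isometric.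
   Formalization: When k > m+3, X is additionally assumed to have at least k points; otherwise the claim fails, e.g. a two-point X has no subsets of any size in the set {k,...,k-m-1}, so its distance is not determined. *)

(* Defs.v *)
From HB Require Import structures.
From mathcomp Require Import all_boot all_order all_algebra finmap.
From mathcomp Require Import ring lra.
From mathcomp Require Import boolp classical_sets reals constructive_ereal.
Set Implicit Arguments.
Unset Strict Implicit.
Unset Printing Implicit Defensive.
Import Order.TTheory GRing.Theory Num.Theory.
Local Open Scope classical_set_scope.
Local Open Scope ring_scope.

(* The library's metricType carries its distance as canonical data of the
   carrier; comparing two metrics on one carrier calls for an unbundled one. *)
Record metric (R : realType) (X : Type) := Metric {
  dist :> X -> X -> R;
  dist_eq0 : forall x y, dist x y = 0 <-> x = y;
  dist_sym : forall x y, dist x y = dist y x;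
  dist_triangle : forall x y z, dist x z <= dist x y + dist y z }.

Definition isometric (R : realType) (X : Type) (d1 d2 : metric R X) : Prop :=
  exists f : X -> X, bijective f /\ forall x y, d2 (f x) (f y) = d1 x y.

(* The infimum of the radii r for which the closed r-balls of M centred at the
   points of P have a common point; open balls give the same infimum. *)
Definition circumradius (R : realType) (M : Type) (d : metric R M)
    (P : set M) : R :=
  inf [set r | exists c, forall q, P q -> d q c <= r].

(* A Cech filtration needs a space in which the balls live: an ambient metric
   space M containing (X, d) isometrically, and a factor turning radii into
   filtration parameters so that every edge {x, y} enters at d x y.  For a
   Euclidean space M the factor is 2: see euclidean_ambient. *)
Record cech_ambient (R : realType) (X : Type) (d : metric R X) := CechAmbient {
  ambient : Type;
  ambient_metric : metric R ambient;
  embed : X -> ambient;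
  scale : R;
  scale_gt0 : 0 < scale;
  embed_isometry : forall x y, ambient_metric (embed x) (embed y) = d x y;
  cech_normalized : forall x y,
    scale * circumradius ambient_metric [set embed x; embed y] = d x y }.

(* Entry parameters of the nonempty simplices of the full complex on S; the
   values at set0 are irrelevant. *)
Section EntryParameters.
Variables (R : realType) (X : choiceType) (d : metric R X) (S : {fset X}).

Definition rips_entry (s : {set S}) : R :=
  \big[Num.max/0]_(x in s) \big[Num.max/0]_(y in s) d (val x) (val y).

Definition cech_entry (A : cech_ambient d) (s : {set S}) : R :=
  scale A * circumradius (ambient_metric A)
              [set embed A (val x) | x in [set x : S | x \in s]].

End EntryParameters.

Section Filtrations.
Variables (T : finType) (R : realType).

(* A filtration of the full simplicial complex on T is given by the entry
   parameters v; `upto` and `before` are the m-skeleta of the complexes of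
   simplices entered at a parameter <= r, respectively < r. *)
Implicit Types (v : {set T} -> R) (m n : nat) (r : R) (K L : {set {set T}}).

Definition skeleton m : {set {set T}} :=
  [set s : {set T} | (s != finset.set0) && (#|s| <= m.+1)%N].
Definition upto v m r : {set {set T}} := [set s in skeleton m | v s <= r].
Definition before v m r : {set {set T}} := [set s in skeleton m | v s < r].

Definition euler_char K : int := \sum_(s in K) (-1) ^+ #|s|.-1.

Definition euler_curve v m : R -> int := fun r => euler_char (upto v m r).

Section Homology.
Variable F : fieldType.

Let C := {ffun {set T} -> F^o}.

Definition simplex_chain (s : {set T}) : C := [ffun t => (t == s)%:R].

(* Vertices are ordered by enum_rank, and the coefficient of c at x |: t
   contributes to the face t with the sign of the position of x in x |: t.
   The empty face is discarded: homology is unreduced. *)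
Definition boundary_fun (c : C) : C := [ffun t =>
  if t == finset.set0 then 0 else
  \sum_(x | x \notin t)
     (-1) ^+ #|[set y in t | (enum_rank y < enum_rank x)%N]%SET| * c (x |: t)%SET].

Definition boundary : 'End(C) := linfun boundary_fun.

Definition chains K n : {vspace C} :=
  <<[seq simplex_chain s | s in [pred s in K | #|s| == n.+1]]>>%VS.
Definition cycles K n : {vspace C} := (chains K n :&: lker boundary)%VS.
Definition boundaries K n : {vspace C} := (boundary @: chains K n.+1)%VS.

(* For K a subcomplex of L, the dimension of Z_n(K) / (Z_n(K) :&: B_n(L)),
   i.e. the rank of H_n(K; F) -> H_n(L; F). *)
Definition persistent_betti K L n : nat :=
  (\dim (cycles K n) - \dim (cycles K n :&: boundaries L n))%N.

(* The degree-n persistence diagram off the diagonal, as the multiplicity of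
   each (birth, death) pair.  As T is finite, the complexes just before b and
   d are those of the simplices entered at a parameter < b, resp. < d. *)
Definition diagram v m n (b : R) (e : \bar R) : int :=
  match e with
  | EFin d =>
      if b < d then
        ((persistent_betti (upto v m b) (before v m d) n)%:Z
          - (persistent_betti (before v m b) (before v m d) n)%:Z)
        - ((persistent_betti (upto v m b) (upto v m d) n)%:Z
          - (persistent_betti (before v m b) (upto v m d) n)%:Z)
      else 0
  | EPInf =>
      (persistent_betti (upto v m b) (skeleton m) n)%:Z
        - (persistent_betti (before v m b) (skeleton m) n)%:Z
  | ENInf => 0
  end.

End Homology.
End Filtrations.

Inductive invariant_kind := RP | RE | CP | CE.

Definition ball_data (R : realType) (X : Type) (lam : invariant_kind)
    (d : metric R X) : Type :=
  match lam with
  | RP | RE => unit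
  | CP | CE => cech_ambient d
  end.

(* Persistence takes its values in families of diagrams indexed by the
   homological degree. *)
Definition value_type (R : realType) (lam : invariant_kind) : Type :=
  match lam with
  | RP | CP => nat -> R -> \bar R -> int
  | RE | CE => R -> int
  end.

Definition evaluate (R : realType) (F : fieldType) (X : choiceType)
    (lam : invariant_kind) (m : nat) (d : metric R X) :
    ball_data lam d -> {fset X} -> value_type R lam :=
  match lam return ball_data lam d -> {fset X} -> value_type R lam with
  | RP => fun _ S => diagram F (rips_entry d (S := S)) m
  | RE => fun _ S => euler_curve (rips_entry d (S := S)) m
  | CP => fun A S => diagram F (cech_entry A (S := S)) m
  | CE => fun A S => euler_curve (cech_entry A (S := S)) m
  end.

Definition Lambda (R : realType) (F : fieldType) (X : choiceType)
    (lam : invariant_kind) (m j : nat) (d : metric R X) (A : ball_data lam d) :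
    set ({fset X} * value_type R lam) :=
  [set (S, evaluate F m A S) | S in [set S : {fset X} | #|` S| = j]].

Definition Lambda_union (R : realType) (F : fieldType) (X : choiceType)
    (lam : invariant_kind) (m : nat) (ks : set nat) (d : metric R X)
    (A : ball_data lam d) : set ({fset X} * value_type R lam) :=
  \bigcup_(j in ks) Lambda F m j A.

Section Euclidean.
Variable R : realType.

Section Space.
Variable n : nat.
Implicit Types x y z u v : 'rV[R]_n.

Definition euclidean_dist x y : R :=
  Num.sqrt (\sum_(i < n) (x 0 i - y 0 i) ^+ 2).

Let dot u v : R := \sum_(i < n) u 0 i * v 0 i.

Lemma euclidean_dist_eq0 x y : euclidean_dist x y = 0 <-> x = y.
Proof.
have ge0 i : 0 <= (x 0 i - y 0 i) ^+ 2 by exact: sqr_ge0.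
split=> [/eqP|->]; last first.
  by rewrite /euclidean_dist big1 ?sqrtr0 // => i _; rewrite subrr expr0n.
rewrite sqrtr_eq0 => le0.
have /eqP : \sum_(i < n) (x 0 i - y 0 i) ^+ 2 = 0.
  by apply/eqP; rewrite eq_le le0 sumr_ge0.
rewrite psumr_eq0 // => /allP h; apply/rowP => i.
by have := h i (mem_index_enum _); rewrite /= sqrf_eq0 subr_eq0 => /eqP.
Qed.

Lemma euclidean_dist_sym x y : euclidean_dist x y = euclidean_dist y x.
Proof. by congr Num.sqrt; apply: eq_bigr => i _; ring. Qed.

Let cauchy_schwarz u v : dot u v ^+ 2 <= dot u u * dot v v.
Proof.
suff: 0 <= \sum_(i < n) \sum_(j < n) (u 0 i * v 0 j - u 0 j * v 0 i) ^+ 2.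
  have -> : \sum_(i < n) \sum_(j < n) (u 0 i * v 0 j - u 0 j * v 0 i) ^+ 2
      = 2 * (dot u u * dot v v - dot u v ^+ 2).
    have eAB : \sum_(i < n) \sum_(j < n) (u 0 i * u 0 i) * (v 0 j * v 0 j)
        = dot u u * dot v v.
      by rewrite mulr_suml; apply: eq_bigr => i _; rewrite mulr_sumr.
    have eBA : \sum_(i < n) \sum_(j < n) (v 0 i * v 0 i) * (u 0 j * u 0 j)
        = dot u u * dot v v.
      rewrite [RHS]mulrC mulr_suml.
      by apply: eq_bigr => i _; rewrite mulr_sumr.
    have eC : \sum_(i < n) \sum_(j < n) (u 0 i * v 0 i) * (u 0 j * v 0 j)
        = dot u v ^+ 2.
      by rewrite expr2 mulr_suml; apply: eq_bigr => i _; rewrite mulr_sumr.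
    transitivity (dot u u * dot v v + dot u u * dot v v - 2 * dot u v ^+ 2);
      last by ring.
    rewrite -{1}eAB -eBA -eC mulr_sumr -big_split -sumrB /=.
    apply: eq_bigr => i _.
    rewrite mulr_sumr -big_split -sumrB /=.
    by apply: eq_bigr => j _; ring.
  by rewrite pmulr_rge0 // subr_ge0.
by apply: sumr_ge0 => i _; apply: sumr_ge0 => j _; exact: sqr_ge0.
Qed.

Lemma euclidean_dist_triangle x y z :
  euclidean_dist x z <= euclidean_dist x y + euclidean_dist y z.
Proof.
have dotE u : \sum_(i < n) u 0 i ^+ 2 = dot u u.
  by apply: eq_bigr => i _; rewrite expr2.
have dE a b : euclidean_dist a b = Num.sqrt (dot (a - b) (a - b)).
  by rewrite -dotE; congr Num.sqrt; apply: eq_bigr => i _; rewrite !mxE.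
rewrite !dE.
set u := x - y; set v := y - z.
have -> : dot (x - z) (x - z) = dot u u + 2 * dot u v + dot v v.
  rewrite mulr_sumr -!big_split /=.
  by apply: eq_bigr => i _; rewrite !mxE; ring.
have uu0 : 0 <= dot u u by rewrite -dotE sumr_ge0 // => i _; exact: sqr_ge0.
have vv0 : 0 <= dot v v by rewrite -dotE sumr_ge0 // => i _; exact: sqr_ge0.
have s0 : 0 <= Num.sqrt (dot u u) + Num.sqrt (dot v v).
  by rewrite addr_ge0 ?sqrtr_ge0.
rewrite -[leRHS]ger0_norm // -sqrtr_sqr; apply: ler_wsqrtr.
rewrite sqrrD !sqr_sqrtr // -sqrtrM // lerD2r lerD2l mulr_natl lerMn2r /=.
by rewrite (le_trans (ler_norm _)) // -sqrtr_sqr ler_wsqrtr.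
Qed.

Definition euclidean_metric : metric R 'rV[R]_n :=
  Metric euclidean_dist_eq0 euclidean_dist_sym euclidean_dist_triangle.

Lemma euclidean_circumradius2 x y :
  2 * circumradius euclidean_metric [set x; y] = euclidean_dist x y.
Proof.
rewrite /circumradius; set E := (X in inf X).
pose c := 2^-1 *: (x + y).
have half a b : euclidean_dist a (2^-1 *: (a + b)) = 2^-1 * euclidean_dist a b.
  rewrite /euclidean_dist.
  rewrite -{2}(@ger0_norm _ 2^-1) ?invr_ge0 // -sqrtr_sqr -sqrtrM ?sqr_ge0 //.
  by rewrite mulr_sumr; congr Num.sqrt; apply: eq_bigr => i _; rewrite !mxE; field.
have lbE : lbound E (2^-1 * euclidean_dist x y).
  move=> r [p hp].
  have hx : euclidean_dist x p <= r by apply: hp; left.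
  have hy : euclidean_dist y p <= r by apply: hp; right.
  have := euclidean_dist_triangle x p y.
  by rewrite (euclidean_dist_sym p y); lra.
have Er : E (2^-1 * euclidean_dist x y).
  exists c => q [->|->]; first by rewrite /= half.
  by rewrite /= /c addrC half (euclidean_dist_sym y).
have -> : inf E = 2^-1 * euclidean_dist x y.
  apply/eqP; rewrite eq_le; apply/andP; split.
    by apply: ge_inf => //; exists (2^-1 * euclidean_dist x y).
  by apply: lb_le_inf => //; exists (2^-1 * euclidean_dist x y).
by rewrite mulrA mulfV ?pnatr_eq0 ?mul1r.
Qed.

End Space.

Variables (X : Type) (n : nat) (f : X -> 'rV[R]_n) (f_inj : injective f).

Definition cloud_metric : metric R X.
Proof.
refine (@Metric _ _ (fun x y => euclidean_dist (f x) (f y)) _ _ _).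
- move=> x y; split=> [h|->]; last exact/euclidean_dist_eq0.
  by apply: f_inj; apply/euclidean_dist_eq0.
- by move=> x y; exact: euclidean_dist_sym.
- by move=> x y z; exact: euclidean_dist_triangle.
Defined.

Definition euclidean_ambient : cech_ambient cloud_metric :=
  @CechAmbient _ _ cloud_metric _ (euclidean_metric n) f 2 (ltr0Sn _ 1)
    (fun _ _ => erefl) (fun x y => euclidean_circumradius2 (f x) (f y)).

End Euclidean.

(* Main.v *)
(* The identity of X is an isometry.  Persistence determines the Euler curve:
   the Betti numbers at parameter r count the intervals born by r and dying
   after r, and Euler-Poincare turns their alternating sum into the Euler
   characteristic.  The Euler characteristic of the m-skeleton on S is the sum,
   over the subsets A of S with at most m + 1 points, of a term depending only
   on A; Moebius inversion over the subsets of S of sizes k - m - 1, .., k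
   recovers each of these terms, and the term of {x, y} vanishes exactly when
   r < d x y.  For k <= m + 3 the space may have fewer than k points, but then
   the sum over S = {x, y} is available and already gives its term. *)
From HB Require Import structures.
Require Import Defs.
From mathcomp Require Import all_boot all_order all_algebra finmap.
From mathcomp Require Import ring lra zify.
From mathcomp Require Import boolp classical_sets reals constructive_ereal.
Set Implicit Arguments.
Unset Strict Implicit.
Unset Printing Implicit Defensive.
Import Order.TTheory GRing.Theory Num.Theory.
Local Open Scope ring_scope.

(** * Simplicial chains and the Euler-Poincare formula *)

Section EulerPoincare.
Variables (T : finType) (F : fieldType).
Implicit Types (K : {set {set T}}) (s t : {set T}) (n : nat).
Let C := {ffun {set T} -> F^o}.
Implicit Types c : C.

Let sgn (x : T) t : F :=
  (-1) ^+ #|[set y in t | (enum_rank y < enum_rank x)%N]%SET|.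

(** [linfun] computes as the given function only once that function is known to be linear. *)
Lemma boundary_fun_is_linear : linear (@boundary_fun T F).
Proof.
move=> a u v; apply/ffunP => t; rewrite !ffunE.
case: ifP => _; first by rewrite scaler0 addr0.
rewrite scaler_sumr -big_split /=; apply: eq_bigr => x _.
by rewrite !ffunE mulrDr -!scalerAr.
Qed.

HB.instance Definition _ := GRing.isLinear.Build F C C *:%R (@boundary_fun T F)
  boundary_fun_is_linear.

Lemma boundaryE c t : boundary T F c t =
  if t == finset.set0 then 0
  else \sum_(x | x \notin t) sgn x t * c (x |: t)%SET.
Proof. by rewrite /boundary lfunE /= ffunE. Qed.

(** Inserting [x] shifts the position of [y] by one exactly when [x] comes first. *)
Let sgnU x y t : x \notin t ->
  sgn y (x |: t) = (-1) ^+ (enum_rank x < enum_rank y)%N * sgn y t.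
Proof.
move=> xt; rewrite /sgn -exprD; congr (_ ^+ _).
set A := [set z in t | _]%SET.
have -> : [set z in x |: t | (enum_rank z < enum_rank y)%N]%SET =
    if (enum_rank x < enum_rank y)%N then (x |: A)%SET else A.
  apply/setP => z; rewrite (fun_if (fun B : {set T} => z \in B)) !inE.
  by case: eqVneq => [->|] /=; case: ifP => //; rewrite (negPf xt).
by case: ifP => _ //; rewrite cardsU1 inE (negPf xt).
Qed.

(** Each coefficient is a sum over ordered pairs of points added to [t]; the two orders reach the
    same simplex with opposite signs and cancel. *)
Lemma boundary_boundary c : boundary T F (boundary T F c) = 0.
Proof.
apply/ffunP => t; rewrite [RHS]ffunE boundaryE.
case: ifPn => // t0.
pose f x y := sgn x t * (sgn y (x |: t)%SET * c (y |: (x |: t))%SET).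
transitivity (\sum_(x | x \notin t) \sum_(y | (y \notin t) && (y != x)) f x y).
  apply: eq_bigr => x xt; rewrite boundaryE -cards_eq0 cardsU1 xt /=.
  rewrite mulr_sumr; apply: eq_bigl => y.
  by rewrite !inE negb_or andbC.
have f_asym x y : x \notin t -> y \notin t ->
    (enum_rank y < enum_rank x)%N -> f x y = - f y x.
  move=> xt yt ltyx; rewrite /f !sgnU // ltyx ltnNge (ltnW ltyx) /=.
  rewrite expr0 expr1 mul1r mulN1r finset.setUCA mulNr mulrN opprK.
  by rewrite !mulrA [sgn x t * _]mulrC.
pose P x y := [&& x \notin t, y \notin t & (enum_rank y < enum_rank x)%N].
transitivity (\sum_x \sum_(y | P x y) f x y + \sum_x \sum_(y | P y x) f x y).
  rewrite big_mkcond -big_split /=; apply: eq_bigr => x _; rewrite /P.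
  case: (boolP (x \notin t)) => xt /=; last first.
    by rewrite !big_pred0 ?addr0// => y; rewrite andbF.
  rewrite (bigID (fun y => (enum_rank y < enum_rank x)%N)) /=; congr (_ + _).
    apply: eq_bigl => y; rewrite -andbA; congr (_ && _).
    case: ltnP => //; rewrite ?andbF // andbT => lt.
    by apply: contraTneq lt => ->; rewrite ltnn.
  apply: eq_bigl => y; rewrite -andbA; congr (_ && _).
  by rewrite -leqNgt ltn_neqAle eq_sym (inj_eq val_inj) (inj_eq enum_rank_inj).
rewrite [X in _ + X](exchange_big_dep xpredT) //= -big_split /= big1 // => x _.
rewrite -big_split big1 // => y /and3P[xt yt lt].
by rewrite /= f_asym // addNr.
Qed.

Lemma simplex_chain_free (l : seq {set T}) : uniq l ->
  free [seq simplex_chain F s | s <- l].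
Proof.
elim: l => [|s l IH] /=; first by rewrite nil_free.
move=> /andP[sl ul]; rewrite free_cons IH // andbT.
(* Evaluation at [s] is 1 on the head and 0 on the tail. *)
apply/negP => /(coord_span (X := in_tuple _)) /ffunP /(_ s).
rewrite sum_ffunE ffunE eqxx big1 => [/eqP|i _]; first by rewrite oner_eq0.
have il : (i < size l)%N by rewrite -(size_map (simplex_chain F) l).
rewrite !ffunE /= (nth_map finset.set0) // ffunE.
case: eqVneq => [es|_]; last by rewrite scaler0.
by rewrite es mem_nth in sl.
Qed.

Lemma chainsP c K n :
  reflect (forall t, c t != 0 -> t \in K /\ #|t| = n.+1) (c \in chains F K n).
Proof.
pose A := [pred s in K | #|s| == n.+1].
apply: (iffP idP) => [|H].
  move=> /(coord_span (X := in_tuple [seq simplex_chain F s | s in A])) -> t.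
  rewrite sum_ffunE => nz.
  have [i] : exists i : 'I_(size [seq simplex_chain F s | s in A]),
      [seq simplex_chain F s | s in A]`_i t != 0.
    apply/existsP; apply: contraNT nz => /existsPn H.
    apply/eqP/big1 => i _; have := H i; rewrite negbK => /eqP.
    by rewrite ffunE => ->; rewrite scaler0.
  have := mem_nth 0 (ltn_ord i) => /fintype.imageP[s /andP[sK /eqP cs] ->].
  by rewrite ffunE; case: (eqVneq t s) => [->//|_]; rewrite eqxx.
have -> : c = \sum_t c t *: simplex_chain F t.
  apply/ffunP => t; rewrite sum_ffunE (bigD1 t) //= !ffunE eqxx.
  rewrite big1 ?addr0 => [|s st]; first by rewrite [LHS](esym (mulr1 _)).
  by rewrite !ffunE eq_sym (negPf st) scaler0.
apply: memv_suml => t _; have [->|/H[tK ct]] := eqVneq (c t) 0.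
  by rewrite scale0r mem0v.
by apply/memvZ/memv_span/fintype.image_f; rewrite inE tK ct eqxx.
Qed.

Lemma dim_chains K n : \dim (chains F K n) = #|[set s in K | #|s| == n.+1]%SET|.
Proof.
have /eqP -> := simplex_chain_free (enum_uniq [pred s in K | #|s| == n.+1]).
by rewrite size_map -cardE; apply: eq_card => s; rewrite !inE.
Qed.

Definition subcomplex K :=
  finset.set0 \notin K /\
  forall s t, s \in K -> t \subset s -> t != finset.set0 -> t \in K.

Lemma boundaries_sub_cycles K n : subcomplex K ->
  (boundaries F K n <= cycles F K n)%VS.
Proof.
move=> [_ cK]; apply/subvP => _ /memv_imgP[c /chainsP Hc ->].
rewrite memv_cap memv_ker boundary_boundary eqxx andbT.
apply/chainsP => t; rewrite boundaryE.
case: ifPn => [_|t0]; first by rewrite eqxx.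
move=> nz.
have [x /andP[xt cx]] : exists x, (x \notin t) && (c (x |: t)%SET != 0).
  apply/existsP; apply: contraNT nz => /existsPn H.
  apply/eqP/big1 => x xt; have := H x; rewrite xt /= negbK => /eqP ->.
  by rewrite mulr0.
have [xK] := Hc _ cx; rewrite cardsU1 xt => -[ct]; split => //.
by apply: cK xK _ t0; rewrite finset.subsetUr.
Qed.

Lemma persistent_bettiE K n : subcomplex K ->
  persistent_betti F K K n =
    (\dim (cycles F K n) - \dim (boundaries F K n))%N.
Proof.
move=> cK; rewrite /persistent_betti.
by rewrite (capv_idPr (boundaries_sub_cycles n cK)).
Qed.

(** The only proper face of a vertex is empty, and [boundary] discards it. *)
Lemma cycles0 K : cycles F K 0 = chains F K 0.
Proof.
apply/capv_idPl/subvP => c /chainsP Hc; rewrite memv_ker; apply/eqP/ffunP => t.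
rewrite boundaryE [RHS]ffunE; case: ifPn => // t0; apply: big1 => x xt.
have [->|/Hc[_]] := eqVneq (c (x |: t)%SET) 0; first by rewrite mulr0.
by rewrite cardsU1 xt => -[/eqP]; rewrite cards_eq0 (negPf t0).
Qed.

Lemma euler_poincare K : subcomplex K ->
  euler_char K = \sum_(n < #|T|) (-1) ^+ n * (persistent_betti F K K n)%:Z.
Proof.
move=> cK; pose z n := (\dim (cycles F K n))%:Z.
pose k n := (\dim (chains F K n))%:Z.
have k0 n : (#|T| <= n)%N -> k n = 0.
  move=> leTn; rewrite /k dim_chains eq_card0 // => s; rewrite !inE.
  by apply/negbTE; rewrite negb_and neq_ltn ltnS (leq_trans (max_card _)) ?orbT.
(* Rank-nullity in degree [n.+1] gives the dimension of the boundaries. *)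
have bE n : (persistent_betti F K K n)%:Z = z n - (k n.+1 - z n.+1).
  rewrite persistent_bettiE // -subzn; last exact/dimvS/boundaries_sub_cycles.
  congr (_ - _); rewrite /k /z /cycles.
  rewrite -(limg_ker_dim (boundary T F) (chains F K n.+1)).
  by rewrite PoszD addrAC subrr add0r.
have kE : euler_char K = \sum_(n < #|T|) (-1) ^+ n * k n.
  transitivity (\sum_(n < #|T|) \sum_(s in K | #|s| == n.+1) (-1) ^+ n : int).
    rewrite /euler_char (exchange_big_dep (fun s => s \in K)) /=; last first.
      by move=> n s _ /andP[].
    apply: eq_bigr => s sK.
    have s0 : (0 < #|s|)%N by rewrite card_gt0; case: cK => K0 _; apply: contraTneq sK => ->.
    have ltsT : (#|s|.-1 < #|T|)%N by rewrite prednK // max_card.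
    rewrite (big_pred1 (Ordinal ltsT)) // => n; rewrite sK /=.
    by rewrite -{1}(prednK s0) eqSS eq_sym.
  apply: eq_bigr => n _; rewrite sumr_const -mulr_natr; congr (_ * _).
  rewrite /k dim_chains natz; congr (Posz _).
  by apply: eq_card => s; rewrite !inE.
(* Up to sign, [g n] is the rank of the boundary map on [n]-chains. It vanishes at both ends, so its
   differences, which turn the terms in [k] into Betti terms, sum to 0. *)
pose g n : int := (-1) ^+ n * (k n - z n).
have gE : \sum_(0 <= n < #|T|) (g n.+1 - g n) = 0.
  rewrite telescope_sumr // /g /k /z cycles0 subrr mulr0 subr0.
  have -> : \dim (cycles F K #|T|) = 0%N.
    have /eqP := k0 _ (leqnn #|T|); rewrite eqz_nat => /eqP kT.
    apply/eqP; rewrite -leqn0 -[X in (_ <= X)%N]kT.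
    by apply: dimvS; exact: capvSl.
  by rewrite subr0 -/(k #|T|) k0 // mulr0.
rewrite kE -[LHS]addr0 -[X in _ + X]gE big_mkord -big_split /=.
apply: eq_bigr => n _; by rewrite bE /g exprS; ring.
Qed.
End EulerPoincare.

(** * Persistence diagrams determine Euler curves *)

Section DiagramToEuler.
Variables (T : finType) (R : realType) (F : fieldType).
Implicit Types (v : {set T} -> R) (m n : nat) (r : R).

Lemma persistent_betti0 L n : persistent_betti F (T := T) finset.set0 L n = 0%N.
Proof.
apply/eqP; rewrite -leqn0 (leq_trans (leq_subr _ _)) //.
rewrite (leq_trans (dimvS (capvSl _ _))) // dim_chains.
by rewrite eq_card0 // => s; rewrite !inE.
Qed.

(* With the values listed in increasing order, the sum of the multiplicities
   over births <= r < deaths telescopes in both variables. *)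
Lemma betti_of_diagram v m n r (s : seq R) :
    sorted <%R s -> r \in s -> (forall t, v t \in s) ->
  (persistent_betti F (upto v m r) (upto v m r) n)%:Z =
  \sum_(b <- s | b <= r) (\sum_(e <- s | r < e) diagram F v m n b e%:E
                          + diagram F v m n b +oo%E).
Proof.
(* [N] is the number of listed values up to and including [r]. *)
move=> ss rs vs; set M := size s; pose N := (index r s).+1.
have NM : (N <= M)%N by rewrite /N index_mem.
have ltE i j : (i < M)%N -> (j < M)%N -> (s`_i < s`_j) = (i < j)%N.
  by move=> iM jM; rewrite (lt_sorted_ltn_nth 0 ss).
have leE i j : (i < M)%N -> (j < M)%N -> (s`_i <= s`_j) = (i <= j)%N.
  by move=> iM jM; rewrite leNgt ltE // -leqNgt.
have rE : s`_(index r s) = r by rewrite nth_index.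
pose ix t := index (v t) s.
have ixM t : (ix t < M)%N by rewrite index_mem.
have vE t : s`_(ix t) = v t by rewrite nth_index.
(* All complexes involved are stages of one finite chain: at the [i]-th value, [before] is [L i] and
   [upto] is [L i.+1]. *)
pose L i := [set t in skeleton T m | (ix t < i)%N]%SET.
have uptoE i : (i < M)%N -> upto v m s`_i = L i.+1.
  by move=> iM; apply/setP => t; rewrite !inE -vE leE.
have beforeE i : (i < M)%N -> before v m s`_i = L i.
  by move=> iM; apply/setP => t; rewrite !inE -vE ltE.
have skelE : skeleton T m = L M by apply/setP => t; rewrite !inE ixM andbT.
have uptor : upto v m r = L N by rewrite -rE uptoE // index_mem.
pose pb i j : int := (persistent_betti F (L i) (L j) n)%:Z.
have finE i j : (i < N)%N -> (N <= j < M)%N ->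
    diagram F v m n s`_i (s`_j)%:E =
      (pb i j.+1 - pb i.+1 j.+1) - (pb i j - pb i.+1 j).
  move=> iN /andP[Nj jM]; have iM := leq_trans iN NM.
  rewrite /diagram ltE // (leq_trans iN Nj) !uptoE // !beforeE //.
  by rewrite -!/(pb _ _); ring.
have infE i : (i < N)%N ->
    diagram F v m n (s`_i) +oo%E = pb i.+1 M - pb i M.
  move=> iN; have iM := leq_trans iN NM.
  by rewrite /diagram skelE uptoE // beforeE.
rewrite uptor -[LHS]/(pb N N) (big_nth 0) -/M.
transitivity (\sum_(0 <= i < N) (pb i.+1 N - pb i N)).
  rewrite telescope_sumr // [pb 0%N N]/pb.
  have -> : L 0%N = finset.set0 by apply/setP => t; rewrite !inE ltn0 andbF.
  by rewrite persistent_betti0 subr0.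
rewrite (big_nat_widen 0 N M) // big_nat_cond [RHS]big_nat_cond.
apply: eq_big => [i|i /andP[/andP[_ iM] iN]].
  case: (ltnP i M) => [iM|]; rewrite ?andbF // -{1}rE leE ?index_mem //.
rewrite infE //.
(* Over the finite deaths the sum telescopes from [N] to [M]; the infinite death cancels the end at
   [M]. *)
transitivity
  (\sum_(N <= j < M) ((pb i j.+1 - pb i.+1 j.+1) - (pb i j - pb i.+1 j))
   + (pb i.+1 M - pb i M)).
  by rewrite (telescope_sumr (fun j => pb i j - pb i.+1 j)) //; ring.
congr (_ + _); rewrite [RHS](big_nth 0) -/M (big_nat_widenl N 0) //.
rewrite big_nat_cond [RHS]big_nat_cond.
apply: eq_big => [j|j /andP[/andP[_ jM] /andP[_ Nj]]]; last first.
  by rewrite finE // Nj.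
by case: (ltnP j M) => [jM|]; rewrite ?andbF // -{1}rE ltE ?index_mem.
Qed.

Lemma euler_curve_of_diagram v1 v2 m :
    (forall s t : {set T}, s != finset.set0 -> s \subset t -> v1 s <= v1 t) ->
    (forall s t : {set T}, s != finset.set0 -> s \subset t -> v2 s <= v2 t) ->
  diagram F v1 m = diagram F v2 m -> euler_curve v1 m = euler_curve v2 m.
Proof.
have sub v r : (forall s t : {set T}, s != finset.set0 -> s \subset t ->
    v s <= v t) -> subcomplex (upto v m r).
  move=> vmono; split=> [|s t]; rewrite !inE ?eqxx //.
  move=> /andP[/andP[_ cs] vs] ts t0.
  rewrite t0 /=.
  rewrite (leq_trans (fintype.subset_leq_card ts) cs) /=.
  exact: le_trans (vmono _ _ t0 ts) vs.
move=> v1mono v2mono eq12; apply/funext => r.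
rewrite /euler_curve !(euler_poincare F); [|exact: sub..].
apply: eq_bigr => n _; congr (_ * _).
(* One list with the values of both filtrations gives both sums the same index set. *)
pose l := r :: [seq v1 t | t : {set T}] ++ [seq v2 t | t : {set T}].
pose s := sort <=%R (undup l).
have ss : sorted <%R s by rewrite sort_lt_sorted undup_uniq.
have mem_s x : x \in s = (x \in l) by rewrite mem_sort mem_undup.
have rs : r \in s by rewrite mem_s mem_head.
rewrite !(betti_of_diagram _ _ ss rs) ?eq12 // => t.
  by rewrite mem_s inE mem_cat (fintype.image_f v2) ?orbT.
by rewrite mem_s inE mem_cat (fintype.image_f v1) ?orbT.
Qed.
End DiagramToEuler.

(** * Moebius inversion over subsets of bounded size *)

Section MoebiusInversion.
Variable X : choiceType.
Implicit Types (A P S : {fset X}) (f : {fset X} -> int).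
Local Open Scope fset_scope.

Definition interval_sum f P S : int := \sum_(A <- fpowerset S | P `<=` A) f A.

(** The sets between [P] and [S] are split by whether they contain [x]. *)
Lemma interval_sumU f P S x : x \in S -> x \notin P ->
  interval_sum f (x |` P) S = interval_sum f P S - interval_sum f P (S `\ x).
Proof.
move=> xS xP; apply/eqP; rewrite eq_sym subr_eq; apply/eqP.
rewrite /interval_sum (bigID (fun A => x \in A)) /=; congr (_ + _)%R.
  by apply: eq_bigl => A; rewrite fsubUset fsub1set andbC.
apply: eq_fbigl_cond => A; rewrite !inE /= !fpowersetE fsubsetD1.
by rewrite -andbA; congr (_ && _); rewrite andbC.
Qed.

(** Emptying [P] point by point removes at most [#|P|] points from [S]; the lower bound on the size
    of [S] keeps all resulting sets in the range of the hypothesis. *)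
Lemma interval_sum_eq f1 f2 k a P S :
    (forall S', (k - a <= #|` S'| <= k)%N ->
      interval_sum f1 fset0 S' = interval_sum f2 fset0 S') ->
    (#|` P| <= a)%N -> P `<=` S -> (k - a + #|` P| <= #|` S| <= k)%N ->
  interval_sum f1 P S = interval_sum f2 P S.
Proof.
move=> H0; have [p] := ubnP #|` P|; elim: p P S => // p IH P S ltPp Pa PS kS.
have [->|/fset0Pn[x xP]] := eqVneq P fset0.
  by apply: H0; lia.
have cP := cardfsD1 x P; rewrite xP add1n in cP.
have xS : x \in S by apply: (fsubsetP PS).
have cS := cardfsD1 x S; rewrite xS add1n in cS.
have sub : P `\ x `<=` S `\ x by apply: fsetSD.
rewrite -(fsetD1K xP) !interval_sumU ?in_fsetD1 ?eqxx //.
by rewrite !(IH (P `\ x)) ?(fsubset_trans sub (fsubsetDl _ _)) //; lia.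
Qed.

Lemma fset_extend A S : (#|` A| <= #|` S|)%N ->
  exists2 B : {fset X}, A `<=` B & #|` B| = #|` S|.
Proof.
have [j] := ubnP (#|` S| - #|` A|); elim: j A => // j IH A lt AS.
have [eAS|neAS] := eqVneq #|` A| #|` S|; first by exists A.
have ltAS : (#|` A| < #|` S|)%N by rewrite ltn_neqAle neAS.
have [x xS xA] : exists2 x, x \in S & x \notin A.
  apply/fsubsetPn; apply: contraL ltAS => /fsubset_leq_card.
  by rewrite -leqNgt.
have cA := cardfsU1 x A; rewrite xA add1n in cA.
have [||B AB cB] := IH (x |` A); [lia|lia|].
by exists B => //; apply: fsubset_trans AB; apply: fsubsetUr.
Qed.

(* The sums over the A with P `<=` A `<=` S agree by interval_sum_eq; descending
   in the cardinality of P, their terms with A != P agree as well. *)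
Lemma moebius_eq f1 f2 k a : (a <= k)%N ->
    (exists S, #|` S| = k) ->
    (forall A, (a < #|` A|)%N -> f1 A = f2 A) ->
    (forall S, (k - a <= #|` S| <= k)%N ->
      \sum_(A <- fpowerset S) f1 A = \sum_(A <- fpowerset S) f2 A) ->
  f1 =1 f2.
Proof.
move=> ak [S0 cS0] big H P.
have [i] := ubnP (a.+1 - #|` P|); elim: i P => // i IH P ltPi.
have [/big//|Pa] := ltnP a #|` P|.
(* With exactly [k] points, [S] meets the size bound of [interval_sum_eq] for every [P] of at most
   [a] points. *)
have [|S PS cS] := @fset_extend P S0; first by rewrite cS0 (leq_trans Pa).
have H0 S' : (k - a <= #|` S'| <= k)%N ->
    interval_sum f1 fset0 S' = interval_sum f2 fset0 S'.
  by move=> /H; rewrite /interval_sum => eqf;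
    rewrite !(eq_bigl _ _ (@fsub0set _)).
have isD1 f : interval_sum f P S =
    (f P + \sum_(A <- fpowerset S `\ P) (if P `<=` A then f A else 0))%R.
  rewrite /interval_sum big_mkcond /= (big_fsetD1 P) ?fpowersetE //=.
  by rewrite fsubset_refl.
have : interval_sum f1 P S = interval_sum f2 P S.
  by apply: (interval_sum_eq H0) => //; lia.
rewrite !isD1.
suff -> : (\sum_(A <- fpowerset S `\ P) (if P `<=` A then f1 A else 0) =
    \sum_(A <- fpowerset S `\ P) (if P `<=` A then f2 A else 0))%R.
  exact: addIr.
apply: eq_fbigr => A; rewrite in_fsetD1 => /andP[AP _] _.
case: ifP => // PA; apply: IH.
have /fproper_ltn_card : P `<` A by rewrite fproperEneq eq_sym AP.
by lia.
Qed.

End MoebiusInversion.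

(** * Entry parameters and Euler terms of finite subsets *)

Section EntryOfSubsets.
Variables (R : realType) (X : choiceType).
Implicit Types (d : metric R X) (A S : {fset X}) (r z : R).
Local Open Scope fset_scope.

Lemma dist_refl (Y : Type) (d : metric R Y) x : d x x = 0.
Proof. exact/dist_eq0. Qed.

Lemma dist_ge0 (Y : Type) (d : metric R Y) x y : 0 <= d x y.
Proof.
by have := dist_triangle d x y x; rewrite dist_refl (dist_sym d y x); lra.
Qed.

(** A point of [P] bounds the radii below by 0, and a ball containing [Q] makes the set of radii
    nonempty, so neither [inf] takes its default value. *)
Lemma circumradius_le (Y : Type) (d : metric R Y) (P Q : set Y) :
    (P `<=` Q)%classic -> (P !=set0)%classic ->
    (exists r c, forall q, Q q -> d q c <= r) ->
  circumradius d P <= circumradius d Q.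
Proof.
move=> PQ [p Pp] [r [c Qc]]; apply: lb_le_inf; first by exists r, c.
move=> z [e Qe]; apply: ge_inf; last by exists e => q /PQ; exact: Qe.
by exists 0 => u [g /(_ _ Pp)]; apply: le_trans; exact: dist_ge0.
Qed.

(** The condition [0 <= z] comes from the initial value of the iterated maximum. *)
Lemma rips_entry_leP d S (s : {set S}) z :
  reflect (0 <= z /\ forall x y, x \in s -> y \in s -> d (val x) (val y) <= z)
          (rips_entry d s <= z).
Proof.
apply: (iffP (bigmax_leP _ _ _ _)) => [[z0 H]|[z0 H]]; split=> //.
  by move=> x y /H/bigmax_leP[_]; exact.
by move=> x xs; apply/bigmax_leP; split=> // y ys; exact: H.
Qed.

(* Every {fset X} carries its own finType; entry values are moved to the
   underlying subsets of X so that they can be compared across these. *)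
Definition rips_fentry d A : R := rips_entry d [set: A]%SET.

Definition cech_fentry d (B : cech_ambient d) A : R :=
  scale B * circumradius (ambient_metric B)
              [set embed B x | x in [set x | x \in A]]%classic.

Definition fentry (lam : invariant_kind) d : ball_data lam d -> {fset X} -> R :=
  match lam return ball_data lam d -> {fset X} -> R with
  | RP | RE => fun _ => rips_fentry d
  | CP | CE => fun B => cech_fentry B
  end.

Lemma rips_fentryE d S (s : {set S}) :
  rips_entry d s = rips_fentry d [fsetval x in s].
Proof.
apply/le_anti/andP; split; apply/rips_entry_leP; split.
- by have /rips_entry_leP[] := lexx (rips_fentry d [fsetval x in s]).
- move=> x y xs ys.
  have /rips_entry_leP[_ H] := lexx (rips_fentry d [fsetval x in s]).
  have mem u : u \in s -> val u \in [fsetval x in s].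
    by move=> us; rewrite in_fset_val /= valK.
  by have := H [` mem x xs] [` mem y ys] (finset.in_setT _) (finset.in_setT _).
- by have /rips_entry_leP[] := lexx (rips_entry d s).
- move=> [x xs] [y ys] _ _ /=.
  have /rips_entry_leP[_ H] := lexx (rips_entry d s).
  move: xs ys => /imfsetP[u /= us ->] /imfsetP[w /= ws ->]; exact: H.
Qed.

Lemma cech_fentryE d (B : cech_ambient d) S (s : {set S}) :
  cech_entry B s = cech_fentry B [fsetval x in s].
Proof.
rewrite /cech_entry /cech_fentry; congr (_ * circumradius _ _)%R.
apply/seteqP; split=> [_ [x xs <-]|_ [x xs <-]].
  by exists (val x) => //; apply/imfsetP; exists x.
by move: xs => /imfsetP[u /= us ->]; exists u.
Qed.

Lemma rips_entry_mono d S (s t : {set S}) : s \subset t ->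
  rips_entry d s <= rips_entry d t.
Proof.
move=> /fintype.subsetP st; have /rips_entry_leP[t0 H] := lexx (rips_entry d t).
by apply/rips_entry_leP; split=> // x y /st xt /st yt; exact: H.
Qed.

Lemma cech_entry_mono d (B : cech_ambient d) S (s t : {set S}) :
  s != finset.set0 -> s \subset t -> cech_entry B s <= cech_entry B t.
Proof.
move=> /finset.set0Pn[x xs] /fintype.subsetP st.
rewrite /cech_entry ler_pM2l ?scale_gt0 //.
apply: circumradius_le.
- by move=> _ [y ys <-]; exists y => //; exact: st.
- by exists (embed B (val x)), x.
(* The ball around a vertex with the diameter of [t] as radius contains [t]. *)
- exists (rips_entry d t), (embed B (val x)) => _ [y /= yt <-].
  rewrite embed_isometry.
  have /rips_entry_leP[_ H] := lexx (rips_entry d t).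
  by apply: H => //; exact: st.
Qed.

(** Here the metric becomes visible to each invariant, in the Cech case through the normalization.
    The case [x = y] covers the vertices. *)
Lemma fentry_edge lam d (B : ball_data lam d) x y :
  fentry B [fset x; y] = d x y.
Proof.
have rE : rips_fentry d [fset x; y] = d x y.
  have xm : x \in [fset x; y] by rewrite !inE eqxx.
  have ym : y \in [fset x; y] by rewrite !inE eqxx orbT.
  apply/le_anti/andP; split.
    apply/rips_entry_leP; split; first exact: dist_ge0.
    move=> [u um] [w wm] _ _ /=; move: um wm; rewrite !inE.
    move=> /orP[] /eqP -> /orP[] /eqP ->;
      by rewrite ?dist_refl ?dist_ge0 // dist_sym.
  have /rips_entry_leP[_ H] := lexx (rips_fentry d [fset x; y]).
  by have := H [` xm] [` ym] (finset.in_setT _) (finset.in_setT _).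
have cE (C : cech_ambient d) : cech_fentry C [fset x; y] = d x y.
  rewrite -(cech_normalized C) /cech_fentry; congr (_ * circumradius _ _)%R.
  apply/seteqP; split=> [_ [u /= um <-]|_ [->|->]].
  - by move: um; rewrite !inE => /orP[] /eqP ->; [left|right].
  - by exists x; rewrite //= !inE eqxx.
  - by exists y; rewrite //= !inE eqxx orbT.
by case: lam B.
Qed.

(** The contribution of [A] to the Euler characteristic at [r], extended by 0 so that inversion
    applies to all finite subsets of [X]. *)
Definition euler_term (w : {fset X} -> R) m r A : int :=
  if [&& A != fset0, (#|` A| <= m.+1)%N & w A <= r]
  then (-1) ^+ #|` A|.-1
  else 0.

Lemma euler_curve_fpowerset S (v : {set S} -> R) w m r :
    (forall s, v s = w [fsetval x in s]) ->
  euler_curve v m r = (\sum_(A <- fpowerset S) euler_term w m r A)%R.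
Proof.
move=> vw; rewrite big_imfset /=; last first.
  by move=> s t _ _ /(congr1 (fsub S)); rewrite !FSetK.
rewrite /euler_curve /euler_char big_mkcond /=.
rewrite big_enum /= [RHS]big_mkcond /=; apply: eq_bigr => s _.
rewrite powersetE finset.subsetT /euler_term -vw !inE.
have -> : #|` [fsetval x in s]| = #|s|.
  by rewrite -(card_fsub (fset_sub_val _ _)) FSetK.
have -> : ([fsetval x in s] == fset0) = (s == finset.set0).
  by rewrite -(fsub_eq0 (fset_sub_val _ _)) FSetK.
by rewrite andbA.
Qed.

End EntryOfSubsets.

(** * Recovering the distances from the invariant *)

Lemma euler_sum_of_evaluate (R : realType) (F : fieldType) (X : choiceType)
    (lam : invariant_kind) (m : nat) (d1 d2 : metric R X)
    (B1 : ball_data lam d1) (B2 : ball_data lam d2) (S : {fset X}) r :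
  evaluate F m B1 S = evaluate F m B2 S ->
  \sum_(A <- fpowerset S) euler_term (fentry B1) m r A =
  \sum_(A <- fpowerset S) euler_term (fentry B2) m r A.
Proof.
case: lam B1 B2 => B1 B2 /= eqE.
- rewrite -!(euler_curve_fpowerset _ _ (rips_fentryE _ (S := S))).
  (* Monotone entry parameters reduce persistence to the Euler curve. *)
  by rewrite (euler_curve_of_diagram _ _ eqE) // => s t _;
    exact: rips_entry_mono.
- by rewrite -!(euler_curve_fpowerset _ _ (rips_fentryE _ (S := S))) eqE.
- rewrite -!(euler_curve_fpowerset _ _ (cech_fentryE _ (S := S))).
  by rewrite (euler_curve_of_diagram _ _ eqE) //; exact: cech_entry_mono.
- by rewrite -!(euler_curve_fpowerset _ _ (cech_fentryE _ (S := S))) eqE.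
Qed.

(* hX: for k >= m + 4 a two-point X has no subset of any of the sizes
   k - m - 1, .., k, so X is required to have at least k points; for
   k <= m + 3 no such requirement is needed. *)
Theorem theorem14 (R : realType) (F : fieldType) (X : choiceType)
    (lam : invariant_kind) (k m : nat)
    (hk : (m + 2 <= k)%N) (hm : (2 < m + 2)%N)
    (hX : (m + 3 < k)%N -> exists S : {fset X}, #|` S|%fset = k)
    (d1 d2 : metric R X) (A1 : ball_data lam d1) (A2 : ball_data lam d2) :
  let ks := [set j : nat | (k - m - 1 <= j <= k)%N]%classic in
  Lambda_union F m ks A1 = Lambda_union F m ks A2 -> isometric d1 d2.
Proof.
move=> ks eqL.
have sum_eq r (S : {fset X}) : (k - m.+1 <= #|` S|%fset <= k)%N ->
    \sum_(A <- fpowerset S) euler_term (fentry A1) m r A =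
    \sum_(A <- fpowerset S) euler_term (fentry A2) m r A.
  move=> cS; apply: (@euler_sum_of_evaluate _ F).
  (* Each value is paired with its own [S], so it can be compared with the other value on the same
     subset. *)
  have : Lambda_union F m ks A2 (S, evaluate F m A1 S).
    by rewrite -eqL; exists #|` S|%fset; [rewrite /ks /=; lia|exists S].
  by case=> j _ [S' _ [-> ->]].
suff term_eq r x y : euler_term (fentry A1) m r [fset x; y]%fset =
    euler_term (fentry A2) m r [fset x; y]%fset.
  exists id; split; first by exists id.
  move=> x y; have le12 r : (d1 x y <= r) = (d2 x y <= r).
    have := term_eq r x y; rewrite /euler_term !fentry_edge.
    have -> : ([fset x; y] != fset0)%fset.
      by apply/fset0Pn; exists x; rewrite !inE eqxx.
    (* Since [m > 0], edges lie in the [m]-skeleton. *)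
    have -> : (#|` [fset x; y]%fset| <= m.+1)%N.
      by rewrite cardfs2; case: eqP; lia.
    by move=> /=; do 2![case: ifP => //] => _ _ /eqP;
      rewrite ?signr_eq0 // eq_sym signr_eq0.
  by apply/le_anti; rewrite -le12 lexx le12 lexx.
have [k3|/hX kS] := leqP k (m + 3); last first.
  (* Sets of more than [m.+1] points contribute 0, which fixes the cutoff. *)
  apply: (@moebius_eq _ _ _ k m.+1) => //; first lia.
    by move=> A; rewrite /euler_term ltnNge => /negPf ->; rewrite andbF.
  exact: sum_eq.
(* Vertices enter at 0 for both metrics. *)
have term1 z : euler_term (fentry A1) m r [fset z]%fset =
    euler_term (fentry A2) m r [fset z]%fset.
  by rewrite -[[fset z]%fset]fsetUid /euler_term !fentry_edge !dist_refl.
have [<-|xy] := eqVneq x y; first by rewrite fsetUid.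
have cxy : #|` [fset x; y]%fset| = 2 by rewrite cardfs2 xy.
have := sum_eq r [fset x; y]%fset; rewrite cxy  => /(_ _).
have -> : (k - m.+1 <= 2 <= k)%N by lia.
move=> /(_ isT).
have pxy : [fset x; y]%fset \in fpowerset [fset x; y]%fset.
  by rewrite fpowersetE.
rewrite (big_fsetD1 _ pxy) [in RHS](big_fsetD1 _ pxy) /=.
(* Besides the edge, only the empty set and the two vertices occur, and their terms agree. *)
suff -> : \sum_(A <- (fpowerset [fset x; y] `\ [fset x; y])%fset)
      euler_term (fentry A1) m r A =
    \sum_(A <- (fpowerset [fset x; y] `\ [fset x; y])%fset)
      euler_term (fentry A2) m r A by exact: addIr.
apply: eq_fbigr => A; rewrite in_fsetD1 fpowersetE => /andP[Axy sA] _.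
have /fproper_ltn_card : (A `<` [fset x; y])%fset by rewrite fproperEneq Axy.
rewrite cxy ltnS; case: (posnP #|` A|%fset) => [/cardfs0_eq -> _|A0 A1le].
  by rewrite /euler_term eqxx.
have /cardfs1P[z ->] : #|` A|%fset == 1%N by lia.
exact: term1.
Qed.
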